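(* There exists an absolute constant $C>0$ such that for every prime power $q$ and all sets $A\subset SL_2(\mathbb{F}_q)$ and $B\subset M_2(\mathbb{F}_q)$ with $|A||B|\ge C\,q^{27/4}$, we have \[\{a_1a_2+b_1+b_2:\ a_1,a_2\in A,\ b_1,b_2\in B\}=M_2(\mathbb{F}_q).\]
   Context: $\mathbb{F}_q$ is the finite field with $q$ elements, $M_2(\mathbb{F}_q)$ is the ring of $2\times 2$ matrices over $\mathbb{F}_q$, and $SL_2(\mathbb{F}_q)$ is the set of matrices in $M_2(\mathbb{F}_q)$ with determinant $1$. *)

(* Defs.v *)
From HB Require Import structures.
From mathcomp Require Import all_boot all_order all_algebra.

Set Implicit Arguments.
Unset Strict Implicit.
Unset Printing Implicit Defensive.

Import GRing.Theory.
Local Open Scope ring_scope.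

Definition SL2 (F : finFieldType) : {set 'M[F]_2} :=
  [set M : 'M[F]_2 | \det M == 1].

Definition prod_sum_set (F : finFieldType) (A B : {set 'M[F]_2}) :
    {set 'M[F]_2} :=
  [set X : 'M[F]_2 | [exists a1 in A, exists a2 in A,
     exists b1 in B, exists b2 in B, X == a1 *m a2 + b1 + b2]].

(* Main.v *)
(* Let g be the indicator of X - B minus its mean |B|/q^4. If X is missed, then
   g (b + a1 a2) = -|B|/q^4 for all a1, a2 in A and b in B, so
     |A| |B| (|A| |B| / q^4)^2 <= \sum_(m, b in M_2) (\sum_(a in A) g (b + m a))^2.
   Expanding the square, the right-hand side is the sum over a, a' in A of
   D (a' - a), where D z is the sum of the autocorrelation of g over the left
   ideal generated by z, with multiplicity. D vanishes at invertible z, and at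
   rank one z it only depends on the point of the projective line spanned by
   the rows of z. Subspaces attached to different points are complementary, so
   the averages of g along them are orthogonal and Bessel's inequality bounds
   the sum of D over the points; moreover a coset of such a subspace through a
   point of SL_2 meets SL_2 in at most q points. Hence the right-hand side is
   at most |A| |B| q^4 (q + 1), that is |A|^2 |B|^2 <= q^12 (q + 1) <= 2 q^13:
   even |A| |B| >= C q^(13/2) suffices. *)
Require Import Defs.
From mathcomp Require Import all_boot all_order all_algebra.
From mathcomp Require Import reals exp.
From mathcomp Require Import ring lra.

Set Implicit Arguments.
Unset Strict Implicit.
Unset Printing Implicit Defensive.

Import Order.TTheory GRing.Theory Num.Theory.
Local Open Scope ring_scope.

(** * Averages over finite abelian groups *)

Lemma sum_translate (R : nmodType) (V : finZmodType) (u : V) (f : V -> R) :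
  \sum_v f (v + u) = \sum_v f v.
Proof. by rewrite [RHS](reindex_inj (addIr u)). Qed.

(** Each translation of [W] lifts along [phi] to a permutation of [V], so the fibres of [phi] have
    equal size. Summing [f (phi v + w)] over all pairs in both orders avoids naming that size. *)
Lemma sum_equivariant (R : pzRingType) (V : finType) (W : finZmodType)
    (phi : V -> W) (f : W -> R) :
  (forall w, exists2 s : V -> V, injective s &
     forall v, phi (s v) = phi v + w) ->
  #|W|%:R * \sum_v f (phi v) = #|V|%:R * \sum_w f w.
Proof.
move=> phi_equiv.
rewrite mulr_natl -sumr_const mulr_natl -sumr_const.
transitivity (\sum_w \sum_v f (phi v + w)).
  apply: eq_bigr => w _; have [s s_inj phi_s] := phi_equiv w.
  by rewrite (reindex_inj s_inj); apply: eq_bigr => v _; rewrite phi_s.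
rewrite exchange_big; apply: eq_bigr => v _.
by rewrite -[RHS](sum_translate (phi v)); apply: eq_bigr => w _; rewrite addrC.
Qed.

(** * Autocorrelation of a function on a finite abelian group *)

Section Autocorrelation.

Variables (R : realFieldType) (V : finZmodType) (g : V -> R).

Definition autocorr (z : V) : R := \sum_b g b * g (b + z).

Lemma sum_autocorr (u v : V) : \sum_b g (b + u) * g (b + v) = autocorr (v - u).
Proof.
rewrite /autocorr -[RHS](sum_translate u); apply: eq_bigr => b _.
by rewrite -addrA [u + _]addrC subrK.
Qed.

Lemma sum_sqr_translates (I : finType) (P : pred I) (t : I -> V) :
  \sum_b (\sum_(i | P i) g (b + t i)) ^+ 2 =
  \sum_(i | P i) \sum_(j | P j) autocorr (t j - t i).
Proof.
under eq_bigr do rewrite expr2 mulr_suml.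
rewrite exchange_big; apply: eq_bigr => i _.
under eq_bigr do rewrite mulr_sumr.
by rewrite exchange_big; apply: eq_bigr => j _; rewrite sum_autocorr.
Qed.

Lemma sum_autocorr_all : \sum_b g b = 0 -> \sum_z autocorr z = 0.
Proof.
move=> g0; rewrite /autocorr exchange_big big1 // => b _.
rewrite -mulr_sumr; under eq_bigr do rewrite addrC.
by rewrite sum_translate g0 mulr0.
Qed.

End Autocorrelation.

(** * Points of the projective line and rank one matrices *)

Section Lines.

Variable F : finFieldType.
Implicit Types (l : option F) (v y : 'cV[F]_2) (z : 'M[F]_2).

(* Representatives (1, 0) and (x, 1) of the points of the projective line. *)
Definition prow l : 'rV[F]_2 :=
  if l is Some x then \row_(j < 2) (if j == 0 then x else 1)
  else \row_(j < 2) (j == 0)%:R.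

Lemma prow0 l : prow l 0 0 = odflt 1 l.
Proof. by case: l => [x|]; rewrite mxE. Qed.

Lemma prow1 l : prow l 0 1 = (l != None)%:R.
Proof. by case: l => [x|]; rewrite mxE. Qed.

Lemma prow_neq0 l : prow l != 0.
Proof.
case: l => [x|]; apply/eqP => /rowP p0.
- by have /eqP := p0 1; rewrite !mxE oner_eq0.
- by have /eqP := p0 0; rewrite !mxE oner_eq0.
Qed.

Lemma ord2P (P : 'I_2 -> Prop) : P 0 -> P 1 -> forall i, P i.
Proof.
move=> P0 P1 [[|[|//]] lt_i].
- by rewrite (_ : Ordinal _ = 0) //; apply: val_inj.
- by rewrite (_ : Ordinal _ = 1) //; apply: val_inj.
Qed.

Lemma det2E z : \det z = z 0 0 * z 1 1 - z 0 1 * z 1 0.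
Proof.
rewrite (expand_det_row _ 0) big_ord_recl big_ord1 /cofactor !det_mx11 !mxE /=.
have e1 : lift ord0 ord0 = 1 :> 'I_2 by apply: val_inj.
have e2 : lift 1 0 = 0 :> 'I_2 by apply: val_inj.
by rewrite !e1 e2 /= expr0 expr1 mul1r mulN1r mulrN.
Qed.

Lemma prow_span l l' z : l != l' ->
  exists v : 'cV[F]_2 * 'cV[F]_2, v.1 *m prow l + v.2 *m prow l' = z.
Proof.
pose D := prow l 0 0 * prow l' 0 1 - prow l 0 1 * prow l' 0 0.
move=> ll'; have D0 : D != 0.
  rewrite /D !prow0 !prow1; case: l l' ll' {D} => [x|] [y|] //= xy.
  - by rewrite mulr1 mul1r subr_eq0.
  - by rewrite mulr0 mulr1 sub0r oppr_eq0 oner_eq0.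
  - by rewrite mulr1 mul0r subr0 oner_eq0.
(* Cramer's rule, applied to each row of [z]; [D] is the determinant of the two representatives. *)
exists (\col_i ((z i 0 * prow l' 0 1 - z i 1 * prow l' 0 0) / D),
        \col_i ((z i 1 * prow l 0 0 - z i 0 * prow l 0 1) / D)).
apply/matrixP => i; apply: ord2P; rewrite !mxE !big_ord1 !mxE /D; field;
  by rewrite -/D.
Qed.

Lemma singular_prow z : z != 0 -> \det z = 0 ->
  exists l, exists2 y, y != 0 & z = y *m prow l.
Proof.
move=> z0 detz; have [c0|c_neq0] := eqVneq (col 1 z) 0.
  exists None, (col 0 z).
    apply: contraNneq z0 => c0'; apply/eqP/matrixP => i; apply: ord2P.
    - by move/colP/(_ i): c0'; rewrite !mxE.
    - by move/colP/(_ i): c0; rewrite !mxE.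
  apply/matrixP => i; apply: ord2P; rewrite !mxE big_ord1 !mxE ?mulr1 ?mulr0 //.
  by move/colP/(_ i): c0; rewrite !mxE.
have [i zi] : exists i, z i 1 != 0.
  have /cV0Pn[i] := c_neq0; rewrite mxE => zi; by exists i.
exists (Some (z i 0 / z i 1)), (col 1 z) => //.
move: detz; rewrite det2E => /eqP; rewrite subr_eq0 => /eqP detz.
apply/matrixP => k; apply: ord2P; rewrite !mxE big_ord1 !mxE /= ?mulr1 //.
apply: (mulIf zi); rewrite mulrA divfK //.
by move: i {zi} k; do 2!apply: ord2P; ring: detz.
Qed.

(** The determinant is affine along a rank one direction: the quadratic terms in [v] cancel. What
    remains is one linear equation in [v], whose coefficients [(s, t)] form [prow l] times the
    adjugate of [a]. They are not both zero, since multiplying by [a] gives [prow l] back. *)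
Lemma card_SL2_line (a : 'M[F]_2) l : \det a = 1 ->
  (#|[set v | (a + v *m prow l)%R \in SL2 F]| <= #|F|)%N.
Proof.
move=> deta.
pose s := prow l 0 0 * a 1 1 - prow l 0 1 * a 1 0.
pose t := prow l 0 1 * a 0 0 - prow l 0 0 * a 0 1.
have inSL2 v : a + v *m prow l \in SL2 F -> s * v 0 0 + t * v 1 0 = 0.
  rewrite inE det2E !mxE !big_ord1 => /eqP; rewrite -deta det2E => detv.
  apply: (addrI (a 0 0 * a 1 1 - a 0 1 * a 1 0)).
  by rewrite addr0 -[RHS]detv /s /t; ring.
have card_by (i : 'I_2) : {in [set v | a + v *m prow l \in SL2 F] &,
    injective (fun v => v i 0)} ->
    (#|[set v | (a + v *m prow l)%R \in SL2 F]| <= #|F|)%N.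
  by move=> inj; rewrite -(card_in_imset inj) max_card.
have [s0|s0] := eqVneq s 0; first have [t0|t0] := eqVneq t 0.
- have := prow_neq0 l; rewrite (_ : prow l = 0) ?eqxx //.
  apply/rowP; apply: ord2P; rewrite mxE -[LHS]mulr1 -deta det2E.
  - transitivity (a 0 0 * s + a 1 0 * t); first by rewrite /s /t; ring.
    by rewrite s0 t0 !mulr0 addr0.
  - transitivity (a 0 1 * s + a 1 1 * t); first by rewrite /s /t; ring.
    by rewrite s0 t0 !mulr0 addr0.
- apply: (card_by 0) => v w; rewrite inE => /inSL2 hv; rewrite inE => /inSL2 hw vw.
  apply/colP; apply: ord2P => //; apply: (mulfI t0).
  by apply: (addrI (s * v 0 0)); rewrite hv vw hw.
- apply: (card_by 1) => v w; rewrite inE => /inSL2 hv; rewrite inE => /inSL2 hw vw.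
  apply/colP; apply: ord2P => //; apply: (mulfI s0).
  by apply: (addIr (t * v 1 0)); rewrite hv vw hw.
Qed.

End Lines.

(** * Energies along left ideals, and the second moment bound *)

Section Energy.

Variables (R : realFieldType) (F : finFieldType) (g : 'M[F]_2 -> R).
Hypothesis sum_g : \sum_b g b = 0.

Let q : R := #|F|%:R.

Let q_gt0 : 0 < q.
Proof. by rewrite ltr0n; apply/card_gt0P; exists 0. Qed.

Let card_cV : #|{: 'cV[F]_2}|%:R = q ^+ 2.
Proof. by rewrite card_mx natrX. Qed.

Let card_M : #|{: 'M[F]_2}|%:R = q ^+ 4.
Proof. by rewrite card_mx natrX. Qed.

Definition line_energy (l : option F) : R :=
  \sum_(v : 'cV[F]_2) autocorr g (v *m prow l).

Definition line_sum (l : option F) (b : 'M[F]_2) : R :=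
  \sum_(v : 'cV[F]_2) g (b + v *m prow l).

Lemma sum_g_line_sum l : \sum_b g b * line_sum l b = line_energy l.
Proof.
rewrite /line_energy exchange_big; apply: eq_bigr => b _.
by rewrite mulr_sumr.
Qed.

Lemma sum_line_sum_sqr l : \sum_b line_sum l b ^+ 2 = q ^+ 2 * line_energy l.
Proof.
rewrite sum_sqr_translates -card_cV mulr_natl -sumr_const; apply: eq_bigr => u _.
rewrite /line_energy -[RHS](sum_translate (- u)); apply: eq_bigr => v _.
by rewrite mulmxBl.
Qed.

Lemma line_energy_ge0 l : 0 <= line_energy l.
Proof.
rewrite -(pmulr_rge0 _ (exprn_gt0 2 q_gt0)) -sum_line_sum_sqr.
by apply: sumr_ge0 => b _; apply: sqr_ge0.
Qed.

(** The sum expands into values of [autocorr g] at [v' *m prow l' - v *m prow l]. By [prow_span]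
    these differences cover all matrices evenly, and the total autocorrelation is 0 because [g] has
    sum 0. *)
Lemma line_sum_orth l l' : l != l' -> \sum_b line_sum l b * line_sum l' b = 0.
Proof.
move=> ll'; rewrite /line_sum.
under eq_bigr do rewrite mulr_suml.
rewrite exchange_big /=.
under eq_bigr do under eq_bigr do rewrite mulr_sumr.
under eq_bigr do rewrite exchange_big /=.
under eq_bigr do under eq_bigr do rewrite sum_autocorr.
rewrite pair_big /=.
apply: (mulfI (lt0r_neq0 (exprn_gt0 4 q_gt0))); rewrite -card_M mulr0.
rewrite (sum_equivariant (phi := fun v => v.2 *m prow l' - v.1 *m prow l)).
  by rewrite sum_autocorr_all ?mulr0.
move=> w; have [[x y] /= xy] := prow_span w ll'.
exists (fun v => (v.1 - x, v.2 + y)).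
  by move=> [a b] [c d] /= [/addIr-> /addIr->].
move=> v /=; rewrite mulmxDl mulmxBl -xy opprB addrACA [RHS]addrACA.
by congr (_ + _); rewrite addrC.
Qed.

(* Bessel's inequality: the functions [line_sum l] are pairwise orthogonal, and
   \sum_b g b * line_sum l b = q^-2 * \sum_b line_sum l b ^+ 2. *)
Lemma sum_line_energy : \sum_l line_energy l <= q ^+ 2 * autocorr g 0.
Proof.
pose h b := \sum_l line_sum l b.
have gh : \sum_b g b * h b = \sum_l line_energy l.
  under eq_bigr do rewrite mulr_sumr.
  by rewrite exchange_big; apply: eq_bigr => l _; apply: sum_g_line_sum.
have hh : \sum_b h b ^+ 2 = q ^+ 2 * \sum_l line_energy l.
  under eq_bigr do rewrite expr2 mulr_suml.
  rewrite exchange_big mulr_sumr; apply: eq_bigr => l _.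
  under eq_bigr do rewrite mulr_sumr.
  rewrite exchange_big (bigD1 l) //= [X in _ + X]big1 ?addr0.
    by rewrite -sum_line_sum_sqr.
  by move=> l' l'l; rewrite line_sum_orth // eq_sym.
have gg : \sum_b g b ^+ 2 = autocorr g 0.
  by apply: eq_bigr => b _; rewrite addr0.
have : 0 <= \sum_b (h b - q ^+ 2 * g b) ^+ 2.
  by apply: sumr_ge0 => b _; apply: sqr_ge0.
have -> : \sum_b (h b - q ^+ 2 * g b) ^+ 2 =
    \sum_b h b ^+ 2 - 2 * q ^+ 2 * \sum_b g b * h b
      + q ^+ 4 * \sum_b g b ^+ 2.
  rewrite !mulr_sumr -sumrB -big_split; apply: eq_bigr => b _ /=; ring.
rewrite gh hh gg => ge0; rewrite -subr_ge0.
rewrite -(pmulr_rge0 _ (exprn_gt0 2 q_gt0)).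
by apply: le_trans ge0 _; rewrite le_eqVlt; apply/orP; left; apply/eqP; ring.
Qed.

Definition ideal_energy (z : 'M[F]_2) : R := \sum_m autocorr g (m *m z).

Lemma ideal_energy0 : ideal_energy 0 = q ^+ 4 * autocorr g 0.
Proof.
rewrite /ideal_energy; under eq_bigr do rewrite mulmx0.
by rewrite sumr_const -card_M mulr_natl.
Qed.

Lemma ideal_energy_unit z : z \in unitmx -> ideal_energy z = 0.
Proof.
move=> zU; rewrite -[RHS](sum_autocorr_all sum_g).
rewrite [RHS](reindex (fun m => m *m z)) //.
by exists (fun m => m *m invmx z) => m _; rewrite ?mulmxK ?mulmxKV.
Qed.

Lemma ideal_energy_line l y : y != 0 ->
  ideal_energy (y *m prow l) = q ^+ 2 * line_energy l.
Proof.
move=> /cV0Pn[i yi].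
apply: (mulfI (lt0r_neq0 (exprn_gt0 2 q_gt0))).
rewrite mulrA -exprD -card_M -card_cV /ideal_energy.
under eq_bigr do rewrite mulmxA.
rewrite (sum_equivariant (phi := fun m => m *m y)
  (fun v => autocorr g (v *m prow l))) // => w.
(* The row [(y i 0)^-1 *: delta_mx 0 i] is a left inverse of [y], so this shift of [m] moves
   [m *m y] by exactly [w]. *)
exists (fun m => m + w *m ((y i 0)^-1 *: delta_mx 0 i)); first exact: addIr.
move=> m; rewrite mulmxDl -mulmxA -scalemxAl -rowE; congr (_ + _).
rewrite (_ : _ *: _ = 1%:M) ?mulmx1 //.
by apply/matrixP => a b; rewrite !ord1 !mxE mulVf.
Qed.

(** The cases zero, rank one and invertible are merged into one sum of indicators, ready to be
    summed over differences [z]. Only an inequality holds, as 0 lies on every line; the surplus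
    terms are nonnegative. *)
Lemma ideal_energy_le z :
  ideal_energy z <= (z == 0)%:R * (q ^+ 4 * autocorr g 0) +
    \sum_l (z \in [set v *m prow l | v in {: 'cV[F]_2}])%:R *
             (q ^+ 2 * line_energy l).
Proof.
have e0 l : 0 <= q ^+ 2 * line_energy l.
  by rewrite mulr_ge0 ?line_energy_ge0 // exprn_ge0 // ltW.
have s0 (P : pred (option F)) (b : option F -> bool) :
    0 <= \sum_(l | P l) (b l)%:R * (q ^+ 2 * line_energy l).
  by apply: sumr_ge0 => l _; rewrite mulr_ge0.
have [->|z0] := eqVneq z 0.
  by rewrite ideal_energy0 mul1r lerDl s0.
rewrite mul0r add0r; have [detz|detz] := eqVneq (\det z) 0; last first.
  by rewrite ideal_energy_unit ?s0 // unitmxE unitfE.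
have [l [y y0 zE]] := singular_prow z0 detz.
have zl : z \in [set v *m prow l | v in {: 'cV[F]_2}] by apply/imsetP; exists y.
by rewrite (bigD1 l) //= zl {1}zE ideal_energy_line // mul1r lerDl s0.
Qed.

Lemma sum_SL2_energy (A : {set 'M[F]_2}) : A \subset SL2 F ->
  \sum_m \sum_b (\sum_(a in A) g (b + m *m a)) ^+ 2 <=
  #|A|%:R * (q ^+ 4 * (q + 1) * autocorr g 0).
Proof.
move=> /subsetP A_SL2.
under eq_bigr do rewrite sum_sqr_translates.
rewrite exchange_big /= mulr_natl -sumr_const; apply: ler_sum => a aA.
rewrite exchange_big /=.
have -> : \sum_(j in A) \sum_m autocorr g (m *m j - m *m a) =
    \sum_(j in A) ideal_energy (j - a).
  apply: eq_bigr => j _; apply: eq_bigr => m _; by rewrite mulmxBr.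
apply: le_trans (ler_sum _ (fun j _ => ideal_energy_le (j - a))) _.
rewrite big_split /= exchange_big /= -mulr_suml.
have -> : \sum_(j in A) (j - a == 0)%:R = 1 :> R.
  rewrite (bigD1 a) //= subrr eqxx big1 ?addr0 // => j /andP[_ ja].
  by rewrite subr_eq0 (negbTE ja).
have line_le l :
    \sum_(j in A) (j - a \in [set v *m prow l | v in {: 'cV[F]_2}])%:R *
      (q ^+ 2 * line_energy l) <= q * (q ^+ 2 * line_energy l).
  set L := [set v *m prow l | v in _].
  have e_ge0 : 0 <= q ^+ 2 * line_energy l.
    by rewrite mulr_ge0 ?line_energy_ge0 ?exprn_ge0 ?(ltW q_gt0).
  rewrite -mulr_suml ler_wpM2r // -natr_sum /q ler_nat.
  have -> : (\sum_(j in A) (j - a \in L)%R)%N = #|[set j in A | (j - a)%R \in L]|.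
    by rewrite -sum1dep_card big_mkcondr.
  have deta : \det a = 1 by move: (A_SL2 _ aA); rewrite inE => /eqP.
  apply: leq_trans (card_SL2_line l deta).
  apply: leq_trans (leq_imset_card (fun v => a + v *m prow l) _).
  apply/subset_leq_card/subsetP => j; rewrite inE => /andP[jA /imsetP[v _ jE]].
  have avE : a + v *m prow l = j by rewrite -jE addrC subrK.
  by apply/imsetP; exists v; rewrite // in_set avE A_SL2.
apply: le_trans (lerD (lexx _) (ler_sum _ (fun l _ => line_le l))) _.
rewrite -!mulr_sumr mul1r.
(* The diagonal term [j = a] gives [q ^+ 4 * autocorr g 0]; the lines give at most
   [q ^+ 3 * q ^+ 2 * autocorr g 0] by Bessel. *)
have := ler_wpM2l (exprn_ge0 3 (ltW q_gt0)) sum_line_energy.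
move: (\sum_l _) (autocorr g 0) => e c; nra.
Qed.

End Energy.

(** * Contradiction from a missed matrix *)

Theorem theorem1p15 (R : realType) :
  exists C : R, 0 < C /\
    forall (F : finFieldType) (A B : {set 'M[F]_2}),
      A \subset SL2 F ->
      C * (#|F|%:R `^ (27%:R / 4%:R)) <= (#|A| * #|B|)%:R ->
      prod_sum_set A B = [set: 'M[F]_2].
Proof.
(* Squaring the hypothesis with this constant gives [4 * q ^+ 13 <= n ^+ 2], as 27/2 exceeds 13 and
   [q >= 1]. This contradicts [n ^+ 2 <= q ^+ 12 * (q + 1)], since [4 * q > q + 1]. *)
exists 2; split=> // F A B A_SL2 AB; apply/setP => X; rewrite [RHS]inE.
pose q : R := #|F|%:R; pose n : R := (#|A| * #|B|)%:R.
have q_ge1 : 1 <= q by rewrite ler1n; apply/card_gt0P; exists 0.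
have q_gt0 : 0 < q by apply: lt_le_trans q_ge1.
have cardM : #|{: 'M[F]_2}|%:R = q ^+ 4 :> R by rewrite card_mx natrX.
have n_sqr_ge : 4 * q ^+ 13 <= n ^+ 2.
  have powq : q ^+ 13 <= (q `^ (27%:R / 4%:R)) ^+ 2.
    rewrite -!powR_mulrn ?powR_ge0 ?(ltW q_gt0) // -powRrM ler_powR //; lra.
  have : (2 * q `^ (27%:R / 4%:R)) ^+ 2 <= n ^+ 2.
    by rewrite lerXn2r ?nnegrE ?mulr_ge0 ?powR_ge0.
  by rewrite exprMn; move: (_ `^ _) powq => t; lra.
have n_gt0 : 0 < n.
  rewrite lt0r ler0n andbT; apply: contraTneq n_sqr_ge => ->.
  by rewrite expr0n -ltNge mulr_gt0 // exprn_gt0.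
(* The goal becomes [~~ true]: a contradiction is to be derived from [X_notin]. *)
apply: contraTT isT => X_notin.
have miss a1 a2 b1 : a1 \in A -> a2 \in A -> b1 \in B ->
    X - (b1 + a1 *m a2) \notin B.
  move=> a1A a2A b1B; apply: contra X_notin => b2B; rewrite inE.
  apply/existsP; exists a1; rewrite a1A; apply/existsP; exists a2; rewrite a2A.
  apply/existsP; exists b1; rewrite b1B; apply/existsP.
  exists (X - (b1 + a1 *m a2)); rewrite b2B /=.
  by rewrite [a1 *m a2 + b1]addrC [b1 + _ + _]addrC subrK.
pose beta : R := #|B|%:R / q ^+ 4.
pose g (b : 'M[F]_2) : R := (X - b \in B)%:R - beta.
have sum_ind : \sum_b (X - b \in B)%:R = #|B|%:R :> R.
  rewrite (reindex_inj (inv_inj (subKr X))) /=.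
  under eq_bigr do rewrite subKr.
  by rewrite -natr_sum -sum1_card [in RHS]big_mkcond.
have beta_card : q ^+ 4 * beta = #|B|%:R.
  by rewrite /beta mulrC divfK // lt0r_neq0 // exprn_gt0.
have sum_g : \sum_b g b = 0.
  by rewrite sumrB sum_ind sumr_const -beta_card -cardM mulr_natl subrr.
have g_sqr : autocorr g 0 <= #|B|%:R.
  (* For an indicator value [i], idempotence gives [(i - beta) ^+ 2 = i - beta * i - beta * (i -
     beta)], and the last term sums to 0. *)
  have -> : autocorr g 0 =
      \sum_b ((X - b \in B)%:R - beta * (X - b \in B)%:R) - beta * \sum_b g b.
    rewrite mulr_sumr -sumrB; apply: eq_bigr => b _; rewrite addr0 /g.
    by case: (_ \in B) => /=; ring.
  rewrite sum_g mulr0 subr0 -sum_ind; apply: ler_sum => b _.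
  by rewrite gerBl mulr_ge0 // /beta divr_ge0 // exprn_ge0 // ltW.
have energy_le := sum_SL2_energy sum_g A_SL2.
have miss_energy : n * (#|A|%:R * beta) ^+ 2 <=
    \sum_m \sum_b (\sum_(a in A) g (b + m *m a)) ^+ 2.
  (* For [m] in [A] and [b] in [B], every [g (b + m *m a)] equals [- beta]; the pairs outside [A]
     and [B] contribute squares, which may be dropped. *)
  have -> : n * (#|A|%:R * beta) ^+ 2 =
      \sum_(m in A) \sum_(b in B) (\sum_(a in A) g (b + m *m a)) ^+ 2.
    rewrite /n natrM -mulrA !mulr_natl -sumr_const; apply: eq_bigr => m mA.
    rewrite -sumr_const; apply: eq_bigr => b bB; rewrite -[RHS]sqrrN -sumrN.
    congr (_ ^+ 2); rewrite -sumr_const; apply: eq_bigr => a aA.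
    by rewrite /g (negbTE (miss _ _ _ mA aA bB)) sub0r opprK.
  rewrite big_mkcond; apply: ler_sum => m _; case: ifP => _; last first.
    by apply: sumr_ge0 => b _; apply: sqr_ge0.
  rewrite big_mkcond; apply: ler_sum => b _; case: ifP => // _.
  exact: sqr_ge0.
have : n * n ^+ 2 <= n * (q ^+ 12 * (q + 1)).
  have -> : n ^+ 2 = q ^+ 8 * (#|A|%:R * beta) ^+ 2.
    by rewrite /n natrM -beta_card; ring.
  have := le_trans miss_energy energy_le.
  have -> : n * (q ^+ 12 * (q + 1)) =
      q ^+ 8 * (#|A|%:R * (q ^+ 4 * (q + 1) * #|B|%:R)).
    by rewrite /n natrM; ring.
  move=> le1; rewrite mulrCA; apply: ler_wpM2l; first by rewrite exprn_ge0 // ltW.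
  apply: le_trans le1 _; rewrite ler_wpM2l // ler_wpM2l //.
  by rewrite mulr_ge0 ?exprn_ge0 ?addr_ge0 // ltW.
rewrite ler_pM2l // => /(le_trans n_sqr_ge).
have q12 : 0 < q ^+ 12 by rewrite exprn_gt0.
rewrite (_ : 4 * q ^+ 13 = q ^+ 12 * (4 * q)); last by ring.
rewrite ler_pM2l //; lra.
Qed.
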